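(* Let $S\subset\mathbb R^2$ be a finite set of $n>4$ points, none of which lies at the center $O$ of SED$(S)$. If $S$ is Pre-regular, then $S$ is not a Half-disk set.
   Context: SED$(S)$ is the smallest closed disk containing $S$, SEC$(S)$ its boundary circle, and $O$ its center. $S$ is \emph{Pre-regular} if there is a regular $n$-gon $P$ (the supporting polygon) such that for every pair of adjacent edges of $P$, one of the two edges contains exactly two points of $S$ (possibly at its endpoints) and the relative interior of the other edge contains no point of $S$. $S$ is a \emph{Half-disk} set if there is a line $\ell$ through $O$ such that exactly one of the two open half-planes bounded by $\ell$ contains no point of $S$. *)

(* Defs.v *)
From Stdlib Require Import Reals Lra List.
Import ListNotations.
Open Scope R_scope.

Definition point : Type := (R * R)%type.

Definition dist (p q : point) : R :=
  sqrt ((fst p - fst q)^2 + (snd p - snd q)^2).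

Definition disk_contains (S : list point) (c : point) (r : R) : Prop :=
  forall p, In p S -> dist p c <= r.

Definition is_SED (S : list point) (c : point) (r : R) : Prop :=
  disk_contains S c r /\
  forall c' r', disk_contains S c' r' -> r <= r'.

Definition on_segment (a b p : point) : Prop :=
  exists t, 0 <= t <= 1 /\
    p = ((1 - t) * fst a + t * fst b, (1 - t) * snd a + t * snd b).

Definition in_rel_interior (a b p : point) : Prop :=
  exists t, 0 < t < 1 /\
    p = ((1 - t) * fst a + t * fst b, (1 - t) * snd a + t * snd b).

Definition reg_vertex (m : nat) (z : point) (rho th : R) (k : nat) : point :=
  (fst z + rho * cos (th + 2 * PI * INR k / INR m),
   snd z + rho * sin (th + 2 * PI * INR k / INR m)).

Definition contains_exactly_two (S : list point) (a b : point) : Prop :=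
  exists p q, In p S /\ In q S /\ p <> q /\ on_segment a b p /\ on_segment a b q /\
    forall x, In x S -> on_segment a b x -> x = p \/ x = q.

Definition rel_interior_empty (S : list point) (a b : point) : Prop :=
  forall x, In x S -> ~ in_rel_interior a b x.

Definition pre_regular (S : list point) : Prop :=
  let n := length S in
  exists (z : point) (rho th : R), 0 < rho /\
    forall k : nat, (k < n)%nat ->
      let v := reg_vertex n z rho th in
      (contains_exactly_two S (v k) (v (k + 1)%nat) /\
       rel_interior_empty S (v (k + 1)%nat) (v (k + 2)%nat))
      \/
      (contains_exactly_two S (v (k + 1)%nat) (v (k + 2)%nat) /\
       rel_interior_empty S (v k) (v (k + 1)%nat)).

Definition cross (d : point) (o p : point) : R :=
  fst d * (snd p - snd o) - snd d * (fst p - fst o).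

Definition half_plane_empty_pos (S : list point) (o d : point) : Prop :=
  forall p, In p S -> ~ (0 < cross d o p).

Definition half_plane_empty_neg (S : list point) (o d : point) : Prop :=
  forall p, In p S -> ~ (cross d o p < 0).

Definition half_disk (S : list point) (o : point) : Prop :=
  exists d : point, d <> (0, 0) /\
    ((half_plane_empty_pos S o d /\ ~ half_plane_empty_neg S o d) \/
     (~ half_plane_empty_pos S o d /\ half_plane_empty_neg S o d)).

(* Main.v *)
(* If an open half-plane bounded by a line through the center of the smallest enclosing disk
   misses S, then two points p, q of S on that line are antipodal on the boundary circle, so
   S lies in a half-disk of diameter pq: every point of S sees pq under an angle at least
   pi/2.  Of any two adjacent edges of the n-gon, one carries exactly two points of S; charging
   to every vertex a point of S on an adjacent edge is injective, so all n points lie on the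
   polygon.  Let p be on an edge and q on the j-th edge after it, going around the empty side.
   If j >= 3 then one of two adjacent edges on the empty side carries points, which is
   impossible.  If j <= 2, comparing with the further points on the edges of p and q, or on the
   edges following them when j = 0, yields an angle smaller than pi/2, as 2 pi / n < pi / 2. *)

From Stdlib Require Import Reals List Lra Lia Psatz Classical.
(* Imported last, since [Reals] has its own [dist]. *)
Require Import Defs.
Open Scope R_scope.

(** * Orientation, angles and half-disks *)

(** Twice the signed area of the triangle [p], [x], [q]: positive exactly when [x] lies strictly to
    the right of the line directed from [p] to [q]. *)
Definition orient (p x q : point) : R :=
  (fst x - fst p) * (snd q - snd p) - (snd x - snd p) * (fst q - fst p).

(** By Thales, this is nonpositive exactly when [x] lies in the closed disk with diameter [pq]. *)
Definition dot_at (p x q : point) : R :=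
  (fst p - fst x) * (fst q - fst x) + (snd p - snd x) * (snd q - snd x).

Definition lerp (a b : point) (t : R) : point :=
  ((1 - t) * fst a + t * fst b, (1 - t) * snd a + t * snd b).

Definition half_disk_diameter (S : list point) (p q : point) : Prop :=
  p <> q /\ In p S /\ In q S /\
  forall x, In x S -> orient p x q <= 0 /\ dot_at p x q <= 0.

(** * The smallest enclosing disk of a half-disk set *)

Lemma forall_small_In (S : list point) (P : point -> R -> Prop) :
  (forall x, In x S -> exists e, 0 < e /\ forall t, 0 < t < e -> P x t) ->
  exists e, 0 < e /\ forall t, 0 < t < e -> forall x, In x S -> P x t.
Proof.
  induction S as [|a S IH]; intros H.
  - exists 1; split; [lra | intros t _ x []].
  - destruct IH as [e1 [He1 H1]]; [intros x Hx; apply H; now right|].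
    destruct (H a (or_introl eq_refl)) as [e2 [He2 H2]].
    exists (Rmin e1 e2); split; [now apply Rmin_pos|].
    intros t Ht x Hx.
    pose proof (Rmin_l e1 e2); pose proof (Rmin_r e1 e2).
    destruct Hx as [<-|Hx]; [apply H2; lra | apply H1; [lra | assumption]].
Qed.

(** A finite set attains its largest distance to [c], so strict inequalities leave room to
    shrink. *)
Lemma disk_shrink (S : list point) (c : point) (r : R) :
  (forall p, In p S -> dist p c < r) ->
  exists r', r' < r /\ disk_contains S c r'.
Proof.
  induction S as [|a S IH]; intros H.
  - exists (r - 1); split; [lra | intros p []].
  - destruct IH as [r1 [H1 H2]]; [intros p Hp; apply H; now right|].
    exists (Rmax r1 (dist a c)); split.
    + apply Rmax_lub_lt; [assumption | apply H; now left].
    + intros p [<-|Hp]; [apply Rmax_r|].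
      apply Rle_trans with r1; [now apply H2 | apply Rmax_l].
Qed.

Lemma dist_sq (p q : point) :
  dist p q * dist p q = (fst p - fst q) ^ 2 + (snd p - snd q) ^ 2.
Proof. unfold dist; apply sqrt_sqrt, Rplus_le_le_0_compat; apply pow2_ge_0. Qed.

Lemma dist_nonneg (p q : point) : 0 <= dist p q.
Proof. apply sqrt_pos. Qed.

Lemma pow2_pos (x : R) : x <> 0 -> 0 < x ^ 2.
Proof. intros H; simpl; rewrite Rmult_1_r; now apply Rsqr_pos_lt. Qed.

Lemma dist_pos (p q : point) : p <> q -> 0 < dist p q.
Proof.
  intros H; apply sqrt_lt_R0.
  destruct p as [a b], q as [c d]; cbn [fst snd].
  destruct (Req_dec a c) as [->|Hac].
  - apply Rplus_le_lt_0_compat; [apply pow2_ge_0 | apply pow2_pos].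
    intros E; apply H; f_equal; lra.
  - apply Rplus_lt_le_0_compat; [apply pow2_pos; lra | apply pow2_ge_0].
Qed.

(* Otherwise moving the center to [O - e n - (e^2 / r) d], where [n = s (- d2, d1)] is the
   normal on the empty side, would bring every point strictly inside the disk of radius [r]:
   the second order term takes care of the only other possible contact point on the line,
   [O - r d]. *)
Lemma SED_diameter_end (S : list point) (O : point) (r s d1 d2 : R) :
  is_SED S O r -> 0 < r -> s * s = 1 -> d1 ^ 2 + d2 ^ 2 = 1 ->
  (forall p, In p S -> s * cross (d1, d2) O p <= 0) ->
  In (fst O + r * d1, snd O + r * d2) S.
Proof.
  intros [Hin Hmin] Hr Hs Hd Hneg.
  apply NNPP; intros Hno.
  destruct O as [o1 o2]; simpl in Hno.
  set (c := fun t => (o1 + s * t * d2 - t * t / r * d1, o2 - s * t * d1 - t * t / r * d2)).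
  assert (Hsmall : exists e, 0 < e /\ forall t, 0 < t < e -> forall x, In x S ->
    dist x (c t) < r).
  { apply forall_small_In; intros [x1 x2] Hx.
    pose proof (Hneg _ Hx) as Hh.
    assert (HD : (x1 - o1) ^ 2 + (x2 - o2) ^ 2 <= r * r).
    { pose proof (dist_sq (x1, x2) (o1, o2)) as E; simpl fst in E; simpl snd in E.
      rewrite <- E; pose proof (Hin _ Hx); pose proof (dist_nonneg (x1, x2) (o1, o2)); nra. }
    unfold cross in Hh; simpl fst in Hh; simpl snd in Hh.
    (* [g] and [h] are the coordinates of [x - O] along the unit vector [d] and the normal [n]. *)
    set (h := s * (d1 * (x2 - o2) - d2 * (x1 - o1))) in *.
    set (g := d1 * (x1 - o1) + d2 * (x2 - o2)).
    assert (Hgh : g * g + h * h = (x1 - o1) ^ 2 + (x2 - o2) ^ 2).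
    { replace (g * g + h * h) with
        (g * g + (s * s) * (d1 * (x2 - o2) - d2 * (x1 - o1)) ^ 2) by (unfold h; ring).
      rewrite Hs; replace ((x1 - o1) ^ 2 + (x2 - o2) ^ 2)
        with ((d1 ^ 2 + d2 ^ 2) * ((x1 - o1) ^ 2 + (x2 - o2) ^ 2)) by (rewrite Hd; ring).
      unfold g; ring. }
    rewrite <- Hgh in HD.
    assert (Hg : - r <= g <= r) by (split; nra).
    (* The left side of the inequality is the squared distance from [x] to the moved center
       [c t]. *)
    assert (Hstep : forall t, 0 < t ->
      g * g + h * h + 2 * t * h + t * t * (2 * (g / r) + 1 + (t / r) * (t / r)) < r * r ->
      dist (x1, x2) (c t) < r).
    { intros t Ht Hlt.
      apply Rsqr_incrst_0; [|apply dist_nonneg | lra].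
      unfold Rsqr; rewrite dist_sq; unfold c; simpl fst; simpl snd.
      replace ((x1 - (o1 + s * t * d2 - t * t / r * d1)) ^ 2 +
               (x2 - (o2 - s * t * d1 - t * t / r * d2)) ^ 2)
        with ((x1 - o1) ^ 2 + (x2 - o2) ^ 2 + 2 * t * h +
              t * t * (2 * (g / r) + (d1 ^ 2 + d2 ^ 2) * (s * s + (t / r) * (t / r))))
        by (unfold g, h; field; lra).
      rewrite Hd, Hs, <- Hgh; lra. }
    assert (Hgr : -1 <= g / r <= 1).
    { split; apply Rmult_le_reg_r with r; try lra; unfold Rdiv;
        rewrite Rmult_assoc, Rinv_l by lra; lra. }
    assert (Htr : forall t, 0 < t < r -> 0 < t / r < 1).
    { intros t Ht; split; [apply Rdiv_lt_0_compat; lra|].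
      apply Rmult_lt_reg_r with r; [lra|]; unfold Rdiv;
        rewrite Rmult_assoc, Rinv_l by lra; lra. }
    assert (Hbr : forall t, 0 < t < r ->
      t * t * (2 * (g / r) + 1 + (t / r) * (t / r)) <= t * t * 4).
    { intros t Ht; specialize (Htr t Ht); apply Rmult_le_compat_l; nra. }
    (* Three cases: [x] inside the circle, where continuity suffices; on the circle off the line,
       where the term [2 t h] wins; on both, where [g = - r] and the coefficient of [t * t] is
       [- 1 + (t / r) ^ 2 < 0]. *)
    destruct (Rle_lt_or_eq_dec _ _ HD) as [HDlt|HDeq].
    - set (D := r * r - (g * g + h * h)).
      exists (Rmin r (Rmin 1 (D / 4))); split.
      { repeat apply Rmin_pos; unfold D; lra. }
      intros t Ht; apply Hstep; [lra|].
      pose proof (Rmin_l r (Rmin 1 (D / 4))); pose proof (Rmin_r r (Rmin 1 (D / 4))).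
      pose proof (Rmin_l 1 (D / 4)); pose proof (Rmin_r 1 (D / 4)).
      specialize (Hbr t ltac:(lra)).
      assert (t * t <= t) by nra.
      assert (t * h <= 0) by nra.
      unfold D in *; lra.
    - destruct (Rle_lt_or_eq_dec _ _ Hh) as [Hhlt|Hheq].
      (* This threshold makes [2 t h + 4 t ^ 2 = 2 t (h + 2 t)] negative. *)
      + exists (Rmin r (- h / 2)); split; [apply Rmin_pos; lra|].
        intros t Ht; apply Hstep; [lra|].
        pose proof (Rmin_l r (- h / 2)); pose proof (Rmin_r r (- h / 2)).
        specialize (Hbr t ltac:(lra)).
        assert (t * (h + 2 * t) < 0) by nra.
        nra.
      + assert (Hz : (g - r) * (g + r) = 0) by (rewrite Hheq in HDeq; lra).
        assert (Hline : d1 * (x2 - o2) - d2 * (x1 - o1) = 0).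
        { transitivity (s * h); [unfold h; rewrite <- Rmult_assoc, Hs; ring | rewrite Hheq; ring]. }
        assert (Hgm : g = - r).
        { apply Rmult_integral in Hz; destruct Hz as [Hz|Hz]; [exfalso | lra].
          apply Hno.
          replace (o1 + r * d1) with x1; [replace (o2 + r * d2) with x2; [assumption|]|].
          - replace r with g by lra.
            replace (g * d2) with ((d1 ^ 2 + d2 ^ 2) * (x2 - o2) -
              d1 * (d1 * (x2 - o2) - d2 * (x1 - o1))) by (unfold g; ring).
            rewrite Hline, Hd; ring.
          - replace r with g by lra.
            replace (g * d1) with ((d1 ^ 2 + d2 ^ 2) * (x1 - o1) +
              d2 * (d1 * (x2 - o2) - d2 * (x1 - o1))) by (unfold g; ring).
            rewrite Hline, Hd; ring. }
        exists r; split; [assumption|].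
        intros t Ht; apply Hstep; [lra|].
        specialize (Htr t Ht).
        replace (g / r) with (-1) by (rewrite Hgm; field; lra).
        rewrite HDeq, Hheq.
        assert (t / r * (t / r) < 1) by nra.
        assert (0 < t * t) by nra.
        nra. }
  destruct Hsmall as [e [He Hlt]].
  destruct (disk_shrink S _ r (Hlt (e / 2) ltac:(lra))) as [r' [Hr' Hc]].
  specialize (Hmin _ _ Hc); lra.
Qed.

(** Both ends of the diameter of the disk along the line belong to [S], by [SED_diameter_end]
    applied to the two directions of the line. *)
Lemma half_plane_diameter (S : list point) (O d : point) (r : R) :
  is_SED S O r -> 0 < r -> d <> (0, 0) ->
  (forall p, In p S -> cross d O p <= 0) ->
  exists p q, half_disk_diameter S p q.
Proof.
  intros HS Hr Hd Hneg.
  set (l := dist d (0, 0)).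
  assert (Hl : 0 < l) by (apply dist_pos; assumption).
  set (d1 := fst d / l); set (d2 := snd d / l).
  assert (Hunit : d1 ^ 2 + d2 ^ 2 = 1).
  { pose proof (dist_sq d (0, 0)) as E; fold l in E; simpl fst in E; simpl snd in E.
    replace (d1 ^ 2 + d2 ^ 2) with (((fst d - 0) ^ 2 + (snd d - 0) ^ 2) / (l * l))
      by (unfold d1, d2; field; lra).
    rewrite <- E; field; lra. }
  assert (Hneg1 : forall p, In p S -> cross (d1, d2) O p <= 0).
  { intros p Hp; specialize (Hneg p Hp).
    replace (cross (d1, d2) O p) with (cross d O p / l)
      by (unfold cross, d1, d2; simpl; field; lra).
    unfold Rdiv; assert (0 < / l) by (apply Rinv_0_lt_compat; assumption); nra. }
  exists (fst O + r * d1, snd O + r * d2), (fst O + r * - d1, snd O + r * - d2).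
  repeat split.
  - intros E; injection E; intros E2 E1.
    assert (r * d1 = 0) by lra; assert (r * d2 = 0) by lra.
    assert (r * r * (d1 ^ 2 + d2 ^ 2) = 0) by nra.
    rewrite Hunit in *; nra.
  - apply (SED_diameter_end S O r 1); try assumption; [ring|].
    intros p Hp; specialize (Hneg1 p Hp); lra.
  (* Reversing the direction flips the normal; [s = -1] restores the same empty side. *)
  - apply (SED_diameter_end S O r (-1)); try assumption; [ring | rewrite <- Hunit; ring |].
    intros p Hp; specialize (Hneg1 p Hp); unfold cross in *; simpl in *; lra.
  - specialize (Hneg1 x H); unfold orient, cross in *; simpl in *; nra.
  (* Since [O] is the midpoint of [pq], [dot_at p x q] is the squared distance from [x] to [O] minus
     [r * r]. *)
  - destruct HS as [Hin _]; specialize (Hin x H).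
    assert (Hle : dist x O * dist x O <= r * r) by (pose proof (dist_nonneg x O); nra).
    rewrite dist_sq in Hle; unfold dot_at; simpl fst; simpl snd.
    assert (Hrr : r * r * (d1 ^ 2 + d2 ^ 2) = r * r) by (rewrite Hunit; ring).
    nra.
Qed.

(** * Diameters joining nearby edges *)

(** The two points are given by their ordered affine parameters, so that positions on an edge are
    compared as real numbers. *)
Definition carries_pair (S : list point) (a b : point) : Prop :=
  exists u1 u2, 0 <= u1 /\ u1 < u2 /\ u2 <= 1 /\
    In (lerp a b u1) S /\ In (lerp a b u2) S /\
    forall u, 0 <= u <= 1 -> In (lerp a b u) S -> u = u1 \/ u = u2.

(** Serves to find a point of [S] on the edge other than an endpoint of the diameter or, for [t]
    equal to 0 or 1, other than a vertex. *)
Lemma carries_pair_other (S : list point) (a b : point) (t : R) :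
  carries_pair S a b -> exists u, 0 <= u <= 1 /\ u <> t /\ In (lerp a b u) S.
Proof.
  intros (u1 & u2 & H0 & H12 & H1 & HI1 & HI2 & _).
  destruct (Req_dec u1 t) as [<-|Hu].
  - exists u2; repeat split; [lra | lra | lra | assumption].
  - exists u1; repeat split; [lra | lra | assumption | assumption].
Qed.

(** In complex notation, [d - b = (c + i s) (b - a)]: the next edge vector is the previous one
    turned by the exterior angle. *)
Definition turn (c s : R) (a b d : point) : Prop :=
  d = (fst b + (c * (fst b - fst a) - s * (snd b - snd a)),
       snd b + (s * (fst b - fst a) + c * (snd b - snd a))).

Definition rot_step (c s : R) (a b : point) : Prop :=
  c ^ 2 + s ^ 2 = 1 /\ 0 < c /\ 0 < s /\
  0 < (fst b - fst a) ^ 2 + (snd b - snd a) ^ 2.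

Lemma lerp_0 (a b : point) : lerp a b 0 = a.
Proof. destruct a, b; unfold lerp; simpl; f_equal; ring. Qed.

Lemma lerp_1 (a b : point) : lerp a b 1 = b.
Proof. destruct a, b; unfold lerp; simpl; f_equal; ring. Qed.

(** A point of [S] on one of the next two edges, other than the first vertex of that edge, lies
    outside the disk whose diameter is a segment of the edge [ab]. *)
Lemma diameter_same_edge (S : list point) (c s : R) (a b d e : point) (t t' : R) :
  rot_step c s a b -> turn c s a b d -> turn c s b d e ->
  carries_pair S b d \/ carries_pair S d e ->
  0 <= t <= 1 -> 0 <= t' <= 1 ->
  half_disk_diameter S (lerp a b t) (lerp a b t') -> False.
Proof.
  intros (Hcs & Hc & Hs & HN) Hd He Hcar Ht Ht' (Hne & _ & _ & Hall).
  assert (Htt : t <> t') by (intros ->; now apply Hne).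
  set (N := (fst b - fst a) ^ 2 + (snd b - snd a) ^ 2) in *.
  (* Coordinates in the frame of the edge vector [b - a] and its normal. *)
  assert (Hout : forall x X Y, In x S ->
    x = (fst a + X * (fst b - fst a) - Y * (snd b - snd a),
         snd a + X * (snd b - snd a) + Y * (fst b - fst a)) ->
    0 < (X - t) * (X - t') + Y * Y -> False).
  { intros x X Y Hx -> Hpos; destruct (Hall _ Hx) as [_ Hdot].
    replace (dot_at _ _ _) with (N * ((X - t) * (X - t') + Y * Y)) in Hdot
      by (unfold dot_at, lerp, N; simpl; ring).
    nra. }
  destruct Hcar as [Hcar|Hcar].
  - destruct (carries_pair_other _ _ _ 0 Hcar) as (u & Hu & Hu0 & HI).
    apply (Hout _ (1 + u * c) (u * s) HI).
    + rewrite Hd; unfold lerp; simpl; f_equal; ring.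
    + assert (0 < u * c) by nra; assert (0 < u * s) by nra; nra.
  - destruct (carries_pair_other _ _ _ 0 Hcar) as (u & Hu & Hu0 & HI).
    assert (0 < s * c) by nra.
    assert (HY : s <= s + u * (2 * (s * c))) by nra.
    apply (Hout _ (1 + c + u * (c ^ 2 - s ^ 2)) (s + u * (2 * (s * c))) HI).
    + rewrite He, Hd; unfold lerp; simpl; f_equal; ring.
    + set (X := 1 + c + u * (c ^ 2 - s ^ 2)).
      (* For [X > 1] the product is positive. Otherwise [c <= 1 / 2], so [Y * Y >= s * s >= 3 / 4],
         while the product is at least [- (t - t') ^ 2 / 4 >= - 1 / 4]. *)
      destruct (Rlt_le_dec 1 X) as [HX|HX].
      * assert (0 < (X - t) * (X - t')) by nra; nra.
      * assert (Hc2 : c <= 1 / 2).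
        { unfold X in HX; destruct (Rle_lt_dec c (1 / 2)) as [|Hc2]; [assumption | exfalso].
          assert (s ^ 2 < 3 / 4) by nra; nra. }
        assert (3 / 4 <= s * s) by nra.
        assert (- (1 / 4) <= (X - t) * (X - t')).
        { assert (0 <= (2 * X - t - t') ^ 2) by apply pow2_ge_0. nra. }
        nra.
Qed.

(** On an edge that carries a pair, the orientation forces the second point to lie beyond the end of
    the diameter, away from [b]; from there the diameter is seen under an acute angle. *)
Lemma diameter_adjacent_edges (S : list point) (c s : R) (a b d : point) (t t' : R) :
  rot_step c s a b -> turn c s a b d ->
  carries_pair S a b \/ carries_pair S b d ->
  0 <= t < 1 -> 0 < t' <= 1 ->
  half_disk_diameter S (lerp a b t) (lerp b d t') -> False.
Proof.
  intros (Hcs & Hc & Hs & HN) Hd Hcar Ht Ht' (_ & _ & _ & Hall).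
  set (N := (fst b - fst a) ^ 2 + (snd b - snd a) ^ 2) in *.
  destruct Hcar as [Hcar|Hcar].
  - destruct (carries_pair_other _ _ _ t Hcar) as (u & Hu & Hut & HI).
    destruct (Hall _ HI) as [Ho Hdot].
    replace (orient _ _ _) with (N * (s * (t' * (u - t)))) in Ho
      by (rewrite Hd; unfold orient, lerp, N; simpl; ring).
    replace (dot_at _ _ _) with (N * ((t - u) * (1 - u + t' * c))) in Hdot
      by (rewrite Hd; unfold dot_at, lerp, N; simpl; ring).
    assert (0 < N * s) by nra; assert (0 < N * s * t') by nra.
    assert (u < t) by nra.
    assert (0 < t' * c) by nra; assert (0 < (t - u) * (1 - u + t' * c)) by nra.
    nra.
  - destruct (carries_pair_other _ _ _ t' Hcar) as (u & Hu & Hut & HI).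
    destruct (Hall _ HI) as [Ho Hdot].
    replace (orient _ _ _) with (N * (s * ((1 - t) * (t' - u)))) in Ho
      by (rewrite Hd; unfold orient, lerp, N; simpl; ring).
    replace (dot_at _ _ _) with (N * ((u - t') * ((c ^ 2 + s ^ 2) * u + (1 - t) * c))) in Hdot
      by (rewrite Hd; unfold dot_at, lerp, N; simpl; ring).
    rewrite Hcs in Hdot.
    assert (0 < N * s) by nra; assert (0 < N * s * (1 - t)) by nra.
    assert (t' < u) by nra.
    assert (0 < (1 - t) * c) by nra; assert (0 < (u - t') * (1 * u + (1 - t) * c)) by nra.
    nra.
Qed.

(* Each of the two outer edges carries a further point beyond the diameter; neither of the angles there need
   be acute by itself, but the two inequalities add up to a contradiction. *)
Lemma diameter_second_neighbour_edges (S : list point) (c s : R) (a b d e : point) (t t' : R) :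
  rot_step c s a b -> turn c s a b d -> turn c s b d e ->
  carries_pair S a b -> carries_pair S d e ->
  0 <= t <= 1 -> 0 <= t' <= 1 ->
  half_disk_diameter S (lerp a b t) (lerp d e t') -> False.
Proof.
  intros (Hcs & Hc & Hs & HN) Hd He Hcar Hcar' Ht Ht' (_ & _ & _ & Hall).
  set (N := (fst b - fst a) ^ 2 + (snd b - snd a) ^ 2) in *.
  destruct (carries_pair_other _ _ _ t Hcar) as (u & Hu & Hut & HI).
  destruct (carries_pair_other _ _ _ t' Hcar') as (u' & Hu' & Hut' & HI').
  destruct (Hall _ HI) as [Ho Hdot]; destruct (Hall _ HI') as [Ho' Hdot'].
  replace (orient _ _ _) with (N * ((s * (1 + t' * (2 * c))) * (u - t))) in Ho
    by (rewrite He, Hd; unfold orient, lerp, N; simpl; ring).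
  replace (dot_at _ _ _) with (N * ((t - u) * (1 - u + c + t' * (c ^ 2 - s ^ 2)))) in Hdot
    by (rewrite He, Hd; unfold dot_at, lerp, N; simpl; ring).
  replace (orient _ _ _) with
    (N * ((s * ((1 - t) * (2 * c) + (c ^ 2 + s ^ 2))) * (t' - u'))) in Ho'
    by (rewrite He, Hd; unfold orient, lerp, N; simpl; ring).
  replace (dot_at _ _ _) with (N * ((u' - t') *
      ((c ^ 2 + s ^ 2) ^ 2 * u' + (c ^ 2 + s ^ 2) * c + (1 - t) * (c ^ 2 - s ^ 2)))) in Hdot'
    by (rewrite He, Hd; unfold dot_at, lerp, N; simpl; ring).
  rewrite Hcs in Ho', Hdot'.
  assert (H1 : u < t).
  { assert (0 < N * (s * (1 + t' * (2 * c)))) by (repeat apply Rmult_lt_0_compat; nra). nra. }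
  assert (H2 : t' < u').
  { assert (0 < N * (s * ((1 - t) * (2 * c) + 1))) by (repeat apply Rmult_lt_0_compat; nra). nra. }
  assert (Hcos : -1 <= c ^ 2 - s ^ 2) by nra.
  assert (H3 : 1 - u + c + t' * (c ^ 2 - s ^ 2) <= 0).
  { assert (0 < N * (t - u)) by nra. nra. }
  assert (H4 : 1 ^ 2 * u' + 1 * c + (1 - t) * (c ^ 2 - s ^ 2) <= 0).
  { assert (0 < N * (u' - t')) by nra. nra. }
  (* Adding [H3] and [H4] and bounding the double-angle cosine below by -1 leaves
     [(t - u) + (u' - t') + 2 c <= 0], a sum of positive terms. *)
  assert ((t' + (1 - t)) * -1 <= (t' + (1 - t)) * (c ^ 2 - s ^ 2))
    by (apply Rmult_le_compat_l; lra).
  nra.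
Qed.

(** * Regular polygons *)

Lemma INR_gt_4 (n : nat) : (4 < n)%nat -> 4 < INR n.
Proof. intros H; apply lt_INR in H; simpl in H; lra. Qed.

(** Here [n > 4] makes the exterior angle acute. *)
Lemma step_angle_bounds (n : nat) : (4 < n)%nat -> 0 < 2 * PI / INR n < PI / 2.
Proof.
  intros H; apply INR_gt_4 in H; pose proof PI_RGT_0.
  split; [apply Rdiv_lt_0_compat; lra|].
  apply Rmult_lt_reg_r with (INR n); [lra|].
  unfold Rdiv; rewrite Rmult_assoc, Rinv_l by lra; nra.
Qed.

Lemma reg_vertex_turn (n : nat) (z : point) (rho th : R) (k : nat) :
  (4 < n)%nat ->
  turn (cos (2 * PI / INR n)) (sin (2 * PI / INR n))
    (reg_vertex n z rho th k) (reg_vertex n z rho th (k + 1)) (reg_vertex n z rho th (k + 2)).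
Proof.
  intros H; apply INR_gt_4 in H.
  unfold turn, reg_vertex; cbn [fst snd].
  set (al := 2 * PI / INR n); set (f := th + 2 * PI * INR k / INR n).
  replace (th + 2 * PI * INR (k + 1) / INR n) with (f + al)
    by (rewrite plus_INR; unfold f, al; simpl; field; lra).
  replace (th + 2 * PI * INR (k + 2) / INR n) with (f + al + al)
    by (rewrite plus_INR; unfold f, al; simpl; field; lra).
  rewrite (cos_plus (f + al)), (sin_plus (f + al)), (cos_plus f al), (sin_plus f al).
  f_equal; ring.
Qed.

Lemma reg_vertex_rot_step (n : nat) (z : point) (rho th : R) (k : nat) :
  (4 < n)%nat -> 0 < rho ->
  rot_step (cos (2 * PI / INR n)) (sin (2 * PI / INR n))
    (reg_vertex n z rho th k) (reg_vertex n z rho th (k + 1)).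
Proof.
  intros H Hrho; pose proof (step_angle_bounds n H) as Hal; apply INR_gt_4 in H.
  unfold rot_step, reg_vertex; cbn [fst snd].
  set (al := 2 * PI / INR n) in *; set (f := th + 2 * PI * INR k / INR n).
  replace (th + 2 * PI * INR (k + 1) / INR n) with (f + al)
    by (rewrite plus_INR; unfold f, al; simpl; field; lra).
  rewrite cos_plus, sin_plus.
  assert (Hcs : forall x, cos x ^ 2 + sin x ^ 2 = 1).
  { intros x; pose proof (sin2_cos2 x) as E; unfold Rsqr in E; lra. }
  assert (0 < cos al) by (apply cos_gt_0; lra).
  assert (0 < sin al) by (apply sin_gt_0; lra).
  repeat split; [apply Hcs | assumption | assumption |].
  (* The squared edge length is [2 rho^2 (1 - cos al)]. *)
  replace (_ + _) with
    (rho ^ 2 * ((cos f ^ 2 + sin f ^ 2) * (cos al ^ 2 + sin al ^ 2 + 1 - 2 * cos al))) by ring.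
  rewrite !Hcs.
  assert (cos al < 1) by (pose proof (Hcs al); nra).
  assert (0 < rho ^ 2) by (apply pow2_pos; lra); nra.
Qed.

Lemma reg_vertex_period (n : nat) (z : point) (rho th : R) (k : nat) :
  (0 < n)%nat -> reg_vertex n z rho th (k + n) = reg_vertex n z rho th k.
Proof.
  intros H; apply lt_0_INR in H; unfold reg_vertex.
  set (f := th + 2 * PI * INR k / INR n).
  replace (th + 2 * PI * INR (k + n) / INR n) with (f + 2 * PI)
    by (rewrite plus_INR; unfold f; field; lra).
  rewrite cos_plus, sin_plus, cos_2PI, sin_2PI; f_equal; ring.
Qed.

(** A triangle inscribed in a circle of radius [rho] has area [2 rho^2 sin A sin B sin C], and its
    angles are half the central angles. *)
Lemma orient_reg_vertex (n : nat) (z : point) (rho th : R) (i k j : nat) :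
  (0 < n)%nat ->
  orient (reg_vertex n z rho th i) (reg_vertex n z rho th k) (reg_vertex n z rho th j) =
  4 * rho ^ 2 * (sin (PI * (INR k - INR i) / INR n) * sin (PI * (INR j - INR k) / INR n) *
    sin (PI * (INR j - INR i) / INR n)).
Proof.
  intros H; apply lt_0_INR in H; unfold orient, reg_vertex; cbn [fst snd].
  set (fi := th + 2 * PI * INR i / INR n).
  set (fk := th + 2 * PI * INR k / INR n).
  set (fj := th + 2 * PI * INR j / INR n).
  set (x := PI * (INR k - INR i) / INR n).
  set (y := PI * (INR j - INR k) / INR n).
  replace (PI * (INR j - INR i) / INR n) with (x + y) by (unfold x, y; field; lra).
  (* It remains to see that [sin 2x + sin 2y - sin 2(x + y) = 4 sin x sin y sin (x + y)]. *)
  transitivity (rho ^ 2 * (sin (fj - fk) + sin (fk - fi) - sin (fj - fi)));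
    [rewrite !sin_minus; ring|].
  replace (fj - fk) with (2 * y) by (unfold fj, fk, y; field; lra).
  replace (fk - fi) with (2 * x) by (unfold fi, fk, x; field; lra).
  replace (fj - fi) with (2 * (x + y)) by (unfold fi, fj, x, y; field; lra).
  rewrite !sin_2a, cos_plus, sin_plus.
  assert (Hcs : forall w, cos w * cos w = 1 - sin w * sin w).
  { intros w; pose proof (sin2_cos2 w) as E; unfold Rsqr in E; lra. }
  replace (2 * (sin x * cos y + cos x * sin y) * (cos x * cos y - sin x * sin y))
    with (2 * (sin x * cos x * (cos y * cos y - sin y * sin y) +
               sin y * cos y * (cos x * cos x - sin x * sin x))) by ring.
  rewrite (Hcs x), (Hcs y); ring.
Qed.

Lemma orient_reg_vertex_pos (n : nat) (z : point) (rho th : R) (i k j : nat) :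
  0 < rho -> (i < k < j)%nat -> (j < i + n)%nat ->
  0 < orient (reg_vertex n z rho th i) (reg_vertex n z rho th k) (reg_vertex n z rho th j).
Proof.
  intros Hrho [Hik Hkj] Hji; rewrite orient_reg_vertex by lia.
  assert (Hsin : forall a b, (a < b)%nat -> (b < a + n)%nat ->
    0 < sin (PI * (INR b - INR a) / INR n)).
  { intros a b Hab Hba; apply lt_INR in Hab; apply lt_INR in Hba; rewrite plus_INR in Hba.
    pose proof PI_RGT_0; apply sin_gt_0.
    - apply Rdiv_lt_0_compat; nra.
    - apply Rmult_lt_reg_r with (INR n); [lra|].
      unfold Rdiv; rewrite Rmult_assoc, Rinv_l by lra; nra. }
  assert (0 < rho ^ 2) by (apply pow2_pos; lra).
  repeat apply Rmult_lt_0_compat; try lra; apply Hsin; lia.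
Qed.

(** * Chords joining two edges *)

Lemma orient_lerp_mid (p a b q : point) (u : R) :
  orient p (lerp a b u) q = (1 - u) * orient p a q + u * orient p b q.
Proof. unfold orient, lerp; simpl; ring. Qed.

Lemma orient_lerp_ends (a b x d e : point) (t t' : R) :
  orient (lerp a b t) x (lerp d e t') =
  (1 - t) * (1 - t') * orient a x d + (1 - t) * t' * orient a x e +
  t * (1 - t') * orient b x d + t * t' * orient b x e.
Proof. unfold orient, lerp; simpl; ring. Qed.

Lemma orient_diag_l (a b : point) : orient a a b = 0.
Proof. unfold orient; ring. Qed.

Lemma orient_diag_r (a b : point) : orient a b b = 0.
Proof. unfold orient; ring. Qed.

Lemma orient_ends_eq (a b : point) : orient a b a = 0.
Proof. unfold orient; ring. Qed.

Lemma orient_reg_vertex_nonneg (n : nat) (z : point) (rho th : R) (i k j : nat) :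
  (0 < n)%nat -> 0 < rho -> (i <= k <= j)%nat -> (j <= i + n)%nat ->
  0 <= orient (reg_vertex n z rho th i) (reg_vertex n z rho th k) (reg_vertex n z rho th j).
Proof.
  intros Hn Hrho [Hik Hkj] Hji.
  destruct (Nat.eq_dec i k) as [->|]; [rewrite orient_diag_l; lra|].
  destruct (Nat.eq_dec k j) as [->|]; [rewrite orient_diag_r; lra|].
  destruct (Nat.eq_dec j (i + n)) as [->|].
  - rewrite reg_vertex_period, orient_ends_eq by assumption; lra.
  - apply Rlt_le, orient_reg_vertex_pos; [assumption | lia | lia].
Qed.

Lemma orient_chord_nonneg (n : nat) (z : point) (rho th : R) (i j k : nat) (t t' : R) :
  let v := reg_vertex n z rho th in
  0 < rho -> (i + 1 <= k <= j)%nat -> (j < i + n)%nat -> 0 <= t <= 1 -> 0 <= t' <= 1 ->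
  0 <= orient (lerp (v i) (v (i + 1)%nat) t) (v k) (lerp (v j) (v (j + 1)%nat) t').
Proof.
  intros v Hrho Hk Hj Ht Ht'; rewrite orient_lerp_ends.
  repeat apply Rplus_le_le_0_compat; repeat apply Rmult_le_pos; try lra;
    apply orient_reg_vertex_nonneg; lia || assumption.
Qed.

(** Of the four orientations in the expansion, only that of [v i], [v k], [v (j + 1)] can vanish,
    when [j + 1 = i + n]. It bears all the weight only for [t = 0] and [t' = 1], and then the ends
    of the chord coincide. *)
Lemma orient_chord_pos (n : nat) (z : point) (rho th : R) (i j k : nat) (t t' : R) :
  let v := reg_vertex n z rho th in
  0 < rho -> (i + 1 < k < j)%nat -> (j < i + n)%nat -> 0 <= t <= 1 -> 0 <= t' <= 1 ->
  lerp (v i) (v (i + 1)%nat) t <> lerp (v j) (v (j + 1)%nat) t' ->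
  0 < orient (lerp (v i) (v (i + 1)%nat) t) (v k) (lerp (v j) (v (j + 1)%nat) t').
Proof.
  intros v Hrho Hk Hj Ht Ht' Hne; rewrite orient_lerp_ends.
  assert (P1 : 0 < orient (v i) (v k) (v j)) by (apply orient_reg_vertex_pos; lia || assumption).
  assert (P2 : 0 <= orient (v i) (v k) (v (j + 1)%nat))
    by (apply orient_reg_vertex_nonneg; lia || assumption).
  assert (P3 : 0 < orient (v (i + 1)%nat) (v k) (v j))
    by (apply orient_reg_vertex_pos; lia || assumption).
  assert (P4 : 0 < orient (v (i + 1)%nat) (v k) (v (j + 1)%nat))
    by (apply orient_reg_vertex_pos; lia || assumption).
  assert (Q1 : 0 <= (1 - t) * (1 - t')) by nra; assert (Q2 : 0 <= (1 - t) * t') by nra.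
  assert (Q3 : 0 <= t * (1 - t')) by nra; assert (Q4 : 0 <= t * t') by nra.
  assert (R2 : 0 <= (1 - t) * t' * orient (v i) (v k) (v (j + 1)%nat)) by nra.
  assert (R1 := Rmult_le_pos _ _ Q1 (Rlt_le _ _ P1)).
  assert (R3 := Rmult_le_pos _ _ Q3 (Rlt_le _ _ P3)).
  assert (R4 := Rmult_le_pos _ _ Q4 (Rlt_le _ _ P4)).
  destruct (Req_dec t 0) as [->|Ht0].
  - destruct (Req_dec t' 1) as [->|Ht1].
    + destruct (Nat.eq_dec (j + 1) (i + n)) as [E|E].
      * elim Hne; unfold v; rewrite E, reg_vertex_period, lerp_0, lerp_1 by lia; reflexivity.
      * assert (0 < orient (v i) (v k) (v (j + 1)%nat))
          by (apply orient_reg_vertex_pos; lia || assumption). lra.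
    + assert (0 < (1 - 0) * (1 - t') * orient (v i) (v k) (v j))
        by (repeat apply Rmult_lt_0_compat; lra). lra.
  - destruct (Req_dec t' 1) as [->|Ht1].
    + assert (0 < t * 1 * orient (v (i + 1)%nat) (v k) (v (j + 1)%nat))
        by (repeat apply Rmult_lt_0_compat; lra). lra.
    + assert (0 < t * (1 - t') * orient (v (i + 1)%nat) (v k) (v j))
        by (repeat apply Rmult_lt_0_compat; lra). lra.
Qed.

(* In case [j >= 3] both edges after the first one have the vertex [i + 2], which lies strictly
   on the empty side of the diameter. *)
Lemma no_half_disk_diameter_on_edges (S : list point) (n : nat) (z : point) (rho th : R)
    (i j : nat) (t t' : R) :
  let v := reg_vertex n z rho th in
  let carries k := carries_pair S (v k) (v (k + 1)%nat) in
  (4 < n)%nat -> 0 < rho -> (forall k, carries k \/ carries (k + 1)%nat) ->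
  (j < n)%nat -> 0 <= t <= 1 -> 0 <= t' <= 1 ->
  half_disk_diameter S (lerp (v i) (v (i + 1)%nat) t)
    (lerp (v (i + j)%nat) (v (i + j + 1)%nat) t') -> False.
Proof.
  intros v carries Hn Hrho Hcar Hj Ht Ht' Hpq.
  assert (Hrot : forall k, rot_step (cos (2 * PI / INR n)) (sin (2 * PI / INR n))
    (v k) (v (k + 1)%nat)) by (intros k; now apply reg_vertex_rot_step).
  assert (Hturn : forall k, turn (cos (2 * PI / INR n)) (sin (2 * PI / INR n))
    (v k) (v (k + 1)%nat) (v (k + 1 + 1)%nat)).
  { intros k; replace (k + 1 + 1)%nat with (k + 2)%nat by lia; now apply reg_vertex_turn. }
  assert (Hsame : forall k w w', 0 <= w <= 1 -> 0 <= w' <= 1 ->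
    half_disk_diameter S (lerp (v k) (v (k + 1)%nat) w) (lerp (v k) (v (k + 1)%nat) w') ->
    False).
  { intros k w w' Hw Hw'; eapply diameter_same_edge; eauto. }
  assert (Hadj : forall k w w', 0 <= w <= 1 -> 0 <= w' <= 1 ->
    half_disk_diameter S (lerp (v k) (v (k + 1)%nat) w)
      (lerp (v (k + 1)%nat) (v (k + 1 + 1)%nat) w') -> False).
  { intros k w w' Hw Hw' H.
    (* An end at the shared vertex puts the whole diameter on one edge. *)
    destruct (Req_dec w 1) as [->|Hw1].
    { apply (Hsame (k + 1)%nat 0 w'); [lra | assumption |].
      now rewrite lerp_0; rewrite lerp_1 in H. }
    destruct (Req_dec w' 0) as [->|Hw0].
    { apply (Hsame k w 1); [assumption | lra |].
      now rewrite lerp_1; rewrite lerp_0 in H. }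
    eapply (diameter_adjacent_edges S _ _ _ _ _ w w'); eauto; try lra; apply Hcar. }
  assert (Hcases : j = 0%nat \/ j = 1%nat \/ j = 2%nat \/ (3 <= j)%nat) by lia.
  destruct Hcases as [->|[->|[->|Hj3]]].
  - rewrite Nat.add_0_r in Hpq; eauto.
  - eauto.
  - replace (i + 2)%nat with (i + 1 + 1)%nat in Hpq by lia.
    destruct (Req_dec t 1) as [->|Ht1].
    { apply (Hadj (i + 1)%nat 0 t'); [lra | assumption |].
      now rewrite lerp_0; rewrite lerp_1 in Hpq. }
    destruct (Req_dec t' 0) as [->|Ht0].
    { apply (Hadj i t 1); [assumption | lra |].
      now rewrite lerp_1; rewrite lerp_0 in Hpq. }
    (* A pair on the middle edge has a point with positive weight at the vertex [i + 2], hence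
       strictly on the empty side. So both outer edges carry pairs. *)
    assert (Hmid : ~ carries (i + 1)%nat).
    { intros Hc; destruct (carries_pair_other _ _ _ 0 Hc) as (u & Hu & Hu0 & HI).
      destruct Hpq as (_ & _ & _ & Hall); destruct (Hall _ HI) as [Ho _].
      rewrite orient_lerp_mid in Ho.
      pose proof (orient_chord_nonneg n z rho th i (i + 1 + 1) (i + 1) t t'
        ltac:(assumption) ltac:(lia) ltac:(lia) Ht Ht').
      assert (0 < orient (lerp (v i) (v (i + 1)%nat) t) (v (i + 1 + 1)%nat)
        (lerp (v (i + 1 + 1)%nat) (v (i + 1 + 1 + 1)%nat) t')).
      { rewrite orient_lerp_ends, !orient_diag_r.
        assert (0 < orient (v i) (v (i + 1 + 1)%nat) (v (i + 1 + 1 + 1)%nat))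
          by (apply orient_reg_vertex_pos; lia || assumption).
        assert (0 < orient (v (i + 1)%nat) (v (i + 1 + 1)%nat) (v (i + 1 + 1 + 1)%nat))
          by (apply orient_reg_vertex_pos; lia || assumption).
        assert (0 < (1 - t) * t') by nra; assert (0 <= t * t') by nra; nra. }
      unfold v in *; nra. }
    destruct (Hcar i) as [Hi|Hi]; [|contradiction].
    destruct (Hcar (i + 1)%nat) as [Hk|Hk]; [contradiction|].
    eapply (diameter_second_neighbour_edges S _ _ (v i) (v (i + 1)%nat) _ _ t t'); eauto.
  - pose proof Hpq as (Hne & _ & _ & Hall).
    assert (H1 : forall k, (i + 1 <= k <= i + 3)%nat ->
      0 <= orient (lerp (v i) (v (i + 1)%nat) t) (v k)
        (lerp (v (i + j)%nat) (v (i + j + 1)%nat) t')).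
    { intros k Hk; apply orient_chord_nonneg; lia || assumption. }
    pose proof (H1 (i + 1)%nat ltac:(lia)); pose proof (H1 (i + 1 + 1 + 1)%nat ltac:(lia)).
    assert (0 < orient (lerp (v i) (v (i + 1)%nat) t) (v (i + 1 + 1)%nat)
        (lerp (v (i + j)%nat) (v (i + j + 1)%nat) t')).
    { apply orient_chord_pos; lia || assumption. }
    (* The excluded parameters 0 and 1 belong to the vertices [i + 1] and [i + 3], so the point
       found has positive weight at [i + 2]. *)
    destruct (Hcar (i + 1)%nat) as [Hc|Hc].
    + destruct (carries_pair_other _ _ _ 0 Hc) as (u & Hu & Hu0 & HI).
      destruct (Hall _ HI) as [Ho _]; rewrite orient_lerp_mid in Ho; nra.
    + destruct (carries_pair_other _ _ _ 1 Hc) as (u & Hu & Hu0 & HI).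
      destruct (Hall _ HI) as [Ho _]; rewrite orient_lerp_mid in Ho; nra.
Qed.

(** * Disjointness of half-open edges *)

Lemma rot_step_neq (c s : R) (a b : point) : rot_step c s a b -> a <> b.
Proof. intros (_ & _ & _ & H) ->; lra. Qed.

Lemma lerp_inj (a b : point) (t u : R) : a <> b -> lerp a b t = lerp a b u -> t = u.
Proof.
  destruct a as [a1 a2], b as [b1 b2]; unfold lerp; simpl; intros Hne E.
  injection E; intros E2 E1.
  assert (Z1 : (t - u) * (b1 - a1) = 0) by lra; assert (Z2 : (t - u) * (b2 - a2) = 0) by lra.
  apply Rmult_integral in Z1; apply Rmult_integral in Z2.
  destruct Z1 as [Z1|Z1]; [lra|]; destruct Z2 as [Z2|Z2]; [lra|].
  elim Hne; f_equal; lra.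
Qed.

(** The half-open edge [j], if different from edge [i], lies strictly to the left of the line
    through edge [i], except for its start [v (i + 1)] when [j = i + 1], which [t < 1] rules out. *)
Lemma half_open_edges_inj (n : nat) (z : point) (rho th : R) (i j : nat) (t t' : R) :
  let v := reg_vertex n z rho th in
  (4 < n)%nat -> 0 < rho -> (i <= j < i + n)%nat -> 0 <= t < 1 -> 0 <= t' < 1 ->
  lerp (v i) (v (i + 1)%nat) t = lerp (v j) (v (j + 1)%nat) t' -> i = j /\ t = t'.
Proof.
  intros v Hn Hrho Hij Ht Ht' E.
  assert (Hv : forall k, v k <> v (k + 1)%nat).
  { intros k; eapply rot_step_neq, reg_vertex_rot_step; assumption. }
  destruct (Nat.eq_dec i j) as [<-|Hne].
  { split; [reflexivity | eapply lerp_inj; eauto]. }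
  exfalso.
  assert (Z : orient (v i) (v (i + 1)%nat) (lerp (v j) (v (j + 1)%nat) t') = 0)
    by (rewrite <- E; unfold orient, lerp; simpl; ring).
  assert (Hexp : orient (v i) (v (i + 1)%nat) (lerp (v j) (v (j + 1)%nat) t') =
    (1 - t') * orient (v i) (v (i + 1)%nat) (v j) +
    t' * orient (v i) (v (i + 1)%nat) (v (j + 1)%nat))
    by (unfold orient, lerp; simpl; ring).
  rewrite Hexp in Z.
  assert (P1 : 0 <= orient (v i) (v (i + 1)%nat) (v j))
    by (apply orient_reg_vertex_nonneg; lia || assumption).
  assert (P2 : 0 <= orient (v i) (v (i + 1)%nat) (v (j + 1)%nat))
    by (apply orient_reg_vertex_nonneg; lia || assumption).
  destruct (Nat.eq_dec j (i + 1)) as [->|Hj].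
  - assert (0 < orient (v i) (v (i + 1)%nat) (v (i + 1 + 1)%nat))
      by (apply orient_reg_vertex_pos; lia || assumption).
    assert (t' = 0) by nra; subst t'.
    assert (E1 : lerp (v i) (v (i + 1)%nat) t = lerp (v i) (v (i + 1)%nat) 1)
      by (now rewrite lerp_1; rewrite lerp_0 in E).
    apply lerp_inj in E1; [lra | apply Hv].
  - assert (0 < orient (v i) (v (i + 1)%nat) (v j))
      by (apply orient_reg_vertex_pos; lia || assumption).
    nra.
Qed.

(** * All points lie on the polygon *)

(** On an edge that carries a pair, [x] is the point of the pair nearer to [b], and not [b] itself;
    [edge_point_before] is the mirror image at [a]. *)
Definition edge_point_after (S : list point) (a b x : point) : Prop :=
  exists u u', 0 <= u' < u /\ u < 1 /\ x = lerp a b u /\ In (lerp a b u') S.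

Definition edge_point_before (S : list point) (a b x : point) : Prop :=
  exists u u', 0 < u < u' /\ u' <= 1 /\ x = lerp a b u /\ In (lerp a b u') S.

(* The point of [S] charged to the vertex [b] between the edges [ab] and [bd]: [b] itself, or the
   point closest to it on one of the two edges that carries a pair. *)
Definition vertex_charge (S : list point) (a b d x : point) : Prop :=
  In x S /\
  (x = b \/ carries_pair S a b /\ edge_point_after S a b x \/
   carries_pair S b d /\ edge_point_before S b d x).

(** Otherwise [x] would lie strictly between two further points of [S], giving three on an edge that
    has two. *)
Lemma edge_point_after_before (S : list point) (a b x : point) :
  a <> b -> In x S -> carries_pair S a b ->
  edge_point_after S a b x -> edge_point_before S a b x -> False.
Proof.
  intros Hab Hx (u1 & u2 & H1 & H12 & H2 & _ & _ & Hu)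
    (w & w' & Hw & Hw1 & -> & HI) (y & y' & Hy & Hy1 & E & HI').
  apply lerp_inj in E; [|assumption]; subst y.
  assert (A := Hu w ltac:(lra) Hx); assert (B := Hu w' ltac:(lra) HI);
    assert (C := Hu y' ltac:(lra) HI').
  destruct A, B, C; lra.
Qed.

Lemma vertex_charge_exists (S : list point) (a b d : point) :
  carries_pair S a b \/ carries_pair S b d -> exists x, vertex_charge S a b d x.
Proof.
  intros H; destruct (classic (In b S)) as [Hb|Hb].
  { exists b; split; [assumption | now left]. }
  destruct H as [H|H]; pose proof H as (u1 & u2 & H1 & H12 & H2 & HI1 & HI2 & _).
  - exists (lerp a b u2); split; [assumption | right; left; split; [assumption|]].
    exists u2, u1; repeat split; try lra; try assumption.
    destruct H2 as [|E]; [assumption | elim Hb; now rewrite E, lerp_1 in HI2].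
  - exists (lerp b d u1); split; [assumption | right; right; split; [assumption|]].
    exists u1, u2; repeat split; try lra; try assumption.
    destruct H1 as [|E]; [assumption | elim Hb; now rewrite <- E, lerp_0 in HI1].
Qed.

(** Two charges can agree only on a common half-open edge, charged from both of its ends;
    [edge_point_after_before] excludes this. *)
Lemma vertex_charge_inj (S : list point) (n : nat) (z : point) (rho th : R) (k k' : nat)
    (x : point) :
  let v := reg_vertex n z rho th in
  (4 < n)%nat -> 0 < rho -> (k < k' < n)%nat ->
  vertex_charge S (v k) (v (k + 1)%nat) (v (k + 1 + 1)%nat) x ->
  vertex_charge S (v k') (v (k' + 1)%nat) (v (k' + 1 + 1)%nat) x -> False.
Proof.
  intros v Hn Hrho Hk [Hx Q] [_ Q'].
  assert (Hv : forall k, v k <> v (k + 1)%nat).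
  { intros m; eapply rot_step_neq, reg_vertex_rot_step; assumption. }
  assert (Hv0 : forall k, v k = lerp (v k) (v (k + 1)%nat) 0) by (intros m; now rewrite lerp_0).
  assert (Hinj : forall i j t t',
    x = lerp (v i) (v (i + 1)%nat) t -> x = lerp (v j) (v (j + 1)%nat) t' ->
    (i <= j < i + n)%nat -> 0 <= t < 1 -> 0 <= t' < 1 -> i = j /\ t = t').
  { intros i j t t' E E' Hij Ht Ht'; apply (half_open_edges_inj n z rho th); try assumption.
    exact (eq_trans (eq_sym E) E'). }
  destruct Q as [E|[[HA Q]|[HA Q]]]; destruct Q' as [E'|[[HA' Q']|[HA' Q']]].
  - rewrite Hv0 in E; rewrite Hv0 in E'.
    destruct (Hinj _ _ _ _ E E' ltac:(lia) ltac:(lra) ltac:(lra)); lia.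
  - rewrite Hv0 in E; destruct Q' as (u & u' & Hu & Hu1 & E' & _).
    destruct (Hinj _ _ _ _ E E' ltac:(lia) ltac:(lra) ltac:(lra)); lra.
  - rewrite Hv0 in E; destruct Q' as (u & u' & Hu & Hu1 & E' & _).
    destruct (Hinj _ _ _ _ E E' ltac:(lia) ltac:(lra) ltac:(lra)); lra.
  - rewrite Hv0 in E'; destruct Q as (u & u' & Hu & Hu1 & E & _).
    (* Wrap-around: here [v (k' + 1)] is [v k], the start of the edge [k]. *)
    destruct (Nat.eq_dec (k' + 1) (k + n)) as [Ek|Ek].
    + rewrite lerp_0, Ek in E'; unfold v in E'; rewrite reg_vertex_period in E' by lia.
      fold (v k) in E'; assert (E1 : lerp (v k) (v (k + 1)%nat) u = lerp (v k) (v (k + 1)%nat) 0)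
        by (now rewrite lerp_0, <- E).
      apply lerp_inj in E1; [lra | apply Hv].
    + destruct (Hinj _ _ _ _ E E' ltac:(lia) ltac:(lra) ltac:(lra)); lra.
  - destruct Q as (u & w & Hu & Hu1 & E & _); destruct Q' as (u' & w' & Hu' & Hu1' & E' & _).
    destruct (Hinj _ _ _ _ E E' ltac:(lia) ltac:(lra) ltac:(lra)); lia.
  - destruct (Nat.eq_dec (k' + 1) (k + n)) as [Ek|Ek].
    + rewrite Ek in Q'; replace (k + n + 1)%nat with (k + 1 + n)%nat in Q' by lia.
      unfold v in Q'; rewrite !reg_vertex_period in Q' by lia.
      exact (edge_point_after_before S _ _ x (Hv k) Hx HA Q Q').
    + destruct Q as (u & w & Hu & Hu1 & E & _); destruct Q' as (u' & w' & Hu' & Hu1' & E' & _).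
      destruct (Hinj _ _ _ _ E E' ltac:(lia) ltac:(lra) ltac:(lra)); lia.
  - rewrite Hv0 in E'; destruct Q as (u & u' & Hu & Hu1 & E & _).
    destruct (Hinj _ _ _ _ E E' ltac:(lia) ltac:(lra) ltac:(lra)); lra.
  - destruct (Nat.eq_dec (k + 1) k') as [Ek|Ek].
    + subst k'; exact (edge_point_after_before S _ _ x (Hv (k + 1)%nat) Hx HA Q' Q).
    + destruct Q as (u & w & Hu & Hu1 & E & _); destruct Q' as (u' & w' & Hu' & Hu1' & E' & _).
      destruct (Hinj _ _ _ _ E E' ltac:(lia) ltac:(lra) ltac:(lra)); lia.
  - destruct Q as (u & w & Hu & Hu1 & E & _); destruct Q' as (u' & w' & Hu' & Hu1' & E' & _).
    destruct (Hinj _ _ _ _ E E' ltac:(lia) ltac:(lra) ltac:(lra)); lia.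
Qed.

Lemma distinct_representatives {A : Type} (S : list A) (Q : nat -> A -> Prop) (n : nat) :
  (forall k, (k < n)%nat -> exists x, In x S /\ Q k x) ->
  (forall k k' x, (k < k' < n)%nat -> Q k x -> Q k' x -> False) ->
  exists l, length l = n /\ NoDup l /\ forall x, In x l -> In x S /\ exists k, (k < n)%nat /\ Q k x.
Proof.
  induction n as [|n IH]; intros Hex Hinj.
  - exists nil; split; [reflexivity | split; [constructor | intros x []]].
  - destruct IH as (l & Hl & Hnd & HQ).
    { intros k Hk; apply Hex; lia. }
    { intros k k' x Hk; apply Hinj; lia. }
    destruct (Hex n ltac:(lia)) as (x & Hx & Qx).
    exists (x :: l); split; [simpl; congruence | split].
    + constructor; [|assumption].
      intros Hin; destruct (HQ x Hin) as (_ & k & Hk & Qk).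
      apply (Hinj k n x); [lia | assumption | assumption].
    + intros y [<-|Hy]; [split; [assumption | exists n; auto]|].
      destruct (HQ y Hy) as (? & k & ? & ?); split; [assumption | exists k; auto].
Qed.

(** The [n] vertices have [n] distinct charges in [S], which has length [n]; so every point of [S]
    is a charge and lies on an edge. *)
Lemma points_on_edges (S : list point) (z : point) (rho th : R) :
  let n := length S in
  let v := reg_vertex n z rho th in
  NoDup S -> (4 < n)%nat -> 0 < rho ->
  (forall k, carries_pair S (v k) (v (k + 1)%nat) \/
             carries_pair S (v (k + 1)%nat) (v (k + 1 + 1)%nat)) ->
  forall p, In p S -> exists k t, (k < n)%nat /\ 0 <= t <= 1 /\
    p = lerp (v k) (v (k + 1)%nat) t.
Proof.
  intros n v HS Hn Hrho Hcar p Hp.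
  destruct (distinct_representatives S
    (fun k x => vertex_charge S (v k) (v (k + 1)%nat) (v (k + 1 + 1)%nat) x) n)
    as (l & Hl & Hnd & HQ).
  - intros k _; destruct (vertex_charge_exists S _ _ _ (Hcar k)) as [x Hx].
    exists x; split; [apply Hx | assumption].
  - intros k k' x Hk; apply vertex_charge_inj; assumption.
  - assert (Hpl : In p l).
    { apply (NoDup_length_incl Hnd (l' := S)); [unfold n in Hl; lia | | assumption].
      intros x Hx; now apply HQ. }
    destruct (HQ p Hpl) as (_ & k & Hk & _ & [E|[[_ Q]|[_ Q]]]).
    + exists k, 1; rewrite lerp_1; repeat split; [assumption | lra | lra | assumption].
    + destruct Q as (u & w & Hu & Hu1 & E & _); exists k, u.
      repeat split; [assumption | lra | lra | assumption].
    + destruct Q as (u & w & Hu & Hu1 & E & _).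
      (* The edge [n] is the edge 0 again, and the index has to stay below [n]. *)
      destruct (Nat.eq_dec (k + 1) n) as [Ek|Ek].
      * exists 0%nat, u; repeat split; [lia | lra | lra |].
        assert (Hper : forall m, v (m + n)%nat = v m)
          by (intros m; apply reg_vertex_period; lia).
        now rewrite E, Ek, <- (Hper 0%nat), <- (Hper (0 + 1)%nat), (Nat.add_comm n 1).
      * exists (k + 1)%nat, u; repeat split; [lia | lra | lra | assumption].
Qed.

(** * From pre-regular sets to half-disks *)

Lemma contains_exactly_two_carries_pair (S : list point) (a b : point) :
  a <> b -> contains_exactly_two S a b -> carries_pair S a b.
Proof.
  intros Hab (p & q & Hp & Hq & Hpq & (t & Ht & Et) & (u & Hu & Eu) & Hall).
  change (p = lerp a b t) in Et; change (q = lerp a b u) in Eu; subst p q.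
  assert (Htu : t <> u) by (intros ->; now apply Hpq).
  assert (Hx : forall w, 0 <= w <= 1 -> In (lerp a b w) S -> w = t \/ w = u).
  { intros w Hw HI.
    destruct (Hall _ HI (ex_intro _ w (conj Hw eq_refl))) as [E|E];
      apply lerp_inj in E; auto. }
  destruct (Rlt_le_dec t u).
  - exists t, u; repeat split; try lra; assumption.
  - exists u, t; repeat split; try lra; try assumption.
    intros w Hw HI; destruct (Hx w Hw HI); auto.
Qed.

(** Periodicity extends the alternative from [k < n] to all [k], so that indices may run past a full
    turn. *)
Lemma pre_regular_carries_pair (S : list point) :
  (4 < length S)%nat -> pre_regular S ->
  exists z rho th, 0 < rho /\ forall k,
    let v := reg_vertex (length S) z rho th in
    carries_pair S (v k) (v (k + 1)%nat) \/ carries_pair S (v (k + 1)%nat) (v (k + 1 + 1)%nat).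
Proof.
  intros Hn (z & rho & th & Hrho & H); exists z, rho, th; split; [assumption|].
  intros k v.
  assert (Hv : forall k, v k <> v (k + 1)%nat).
  { intros m; eapply rot_step_neq, reg_vertex_rot_step; assumption. }
  induction k as [k IH] using (well_founded_induction Wf_nat.lt_wf).
  destruct (Nat.lt_ge_cases k (length S)) as [Hk|Hk].
  - replace (k + 1 + 1)%nat with (k + 2)%nat by lia.
    destruct (H k Hk) as [[Hc _]|[Hc _]]; [left | right];
      apply contains_exactly_two_carries_pair; try assumption; [apply Hv|].
    fold v; replace (k + 2)%nat with (k + 1 + 1)%nat by lia; apply Hv.
  - specialize (IH (k - length S)%nat ltac:(lia)).
    assert (Hper : forall m, v (m + length S)%nat = v m)
      by (intros m; apply reg_vertex_period; lia).
    rewrite <- (Hper (k - length S)%nat), <- (Hper (k - length S + 1)%nat),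
      <- (Hper (k - length S + 1 + 1)%nat) in IH.
    replace (k - length S + length S)%nat with k in IH by lia.
    replace (k - length S + 1 + length S)%nat with (k + 1)%nat in IH by lia.
    now replace (k - length S + 1 + 1 + length S)%nat with (k + 1 + 1)%nat in IH by lia.
Qed.

Lemma pre_regular_no_half_disk_diameter (S : list point) (p q : point) :
  NoDup S -> (4 < length S)%nat -> pre_regular S -> ~ half_disk_diameter S p q.
Proof.
  intros HS Hn Hpre Hpq.
  destruct (pre_regular_carries_pair S Hn Hpre) as (z & rho & th & Hrho & Hcar).
  set (n := length S) in *; set (v := reg_vertex n z rho th) in *.
  pose proof Hpq as (_ & Hp & Hq & _).
  destruct (points_on_edges S z rho th HS Hn Hrho Hcar p Hp) as (i & t & Hi & Ht & ->).
  destruct (points_on_edges S z rho th HS Hn Hrho Hcar q Hq) as (j & t' & Hj & Ht' & ->).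
  fold n v in Hpq, Hi, Hj.
  destruct (Nat.le_gt_cases i j) as [Hij|Hij].
  - replace j with (i + (j - i))%nat in Hpq by lia.
    eapply (no_half_disk_diameter_on_edges S n z rho th i (j - i) t t'); eauto; lia.
  (* The edge of [q] comes before that of [p]: shift it by a full turn. *)
  - apply (no_half_disk_diameter_on_edges S n z rho th i (j + n - i) t t'); auto; [lia|].
    replace (i + (j + n - i))%nat with (j + n)%nat by lia.
    replace (j + n + 1)%nat with (j + 1 + n)%nat by lia.
    now rewrite !reg_vertex_period by lia.
Qed.

Theorem theorem5p4 (S : list point) (O : point) (r : R) :
  NoDup S ->
  (4 < length S)%nat ->
  is_SED S O r ->
  (forall p, In p S -> p <> O) ->
  pre_regular S ->
  ~ half_disk S O.
Proof.
  intros HS Hn HO Hne Hpre (d & Hd & Hhalf).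
  assert (Hr : 0 < r).
  { destruct S as [|p S']; [simpl in Hn; lia|].
    destruct HO as [Hin _]; specialize (Hin p (or_introl eq_refl)).
    pose proof (dist_pos p O (Hne p (or_introl eq_refl))); lra. }
  assert (Hex : exists p q, half_disk_diameter S p q).
  { destruct Hhalf as [[H _]|[_ H]].
    - apply (half_plane_diameter S O d r); try assumption.
      intros p Hp; specialize (H p Hp); lra.
    (* Reversing [d] exchanges the two half-planes. *)
    - apply (half_plane_diameter S O (- fst d, - snd d) r); try assumption.
      + intros E; apply Hd; injection E; intros; destruct d; simpl in *; f_equal; lra.
      + intros p Hp; specialize (H p Hp); unfold cross in *; simpl; lra. }
  destruct Hex as (p & q & Hpq).
  now apply (pre_regular_no_half_disk_diameter S p q).
Qed.
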